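(* Let $\mathcal{Q}=(Q_n)_{n\ge 1}$ be a defective adapted cocycle. Assume that $\mathcal{Q}$ has a finite second moment and satisfies the second-moment deviation inequality with respect to the probability measure $\mu$, with constant $\tau_2(\mu;\mathcal{Q})$. Define $C^+(\mu;\mathcal{Q}):=4\chi_2(\mu;\mathcal{Q})+16\,\tau_2(\mu;\mathcal{Q})$. Then for all $n\ge1$, $$\mathbb{V}^\mu[Q_n]\le C^+(\mu;\mathcal{Q})\,n.$$
   Context: Let $(G,\mathcal{G})$ be a measurable space, $\mu$ a probability measure on $G$, $\Omega=G^{\mathbb{N}^*}$ with $\mathbb{N}^*=\{1,2,\dots\}$, equipped with the product $\sigma$-field and the product measure $\mathbb{P}^\mu=\mu^{\otimes\mathbb{N}^*}$. $\mathbb{E}^\mu$ and $\mathbb{V}^\mu$ denote expectation and variance under $\mathbb{P}^\mu$. $X_n:\Omega\to G$ are the coordinate maps, $\mathcal{F}_n=\sigma(X_1,\dots,X_n)$, and $\theta_n(\omega_1,\omega_2,\dots)=(\omega_{n+1},\omega_{n+2},\dots)$. A defective adapted cocycle is a sequence $\mathcal{Q}=(Q_n)_{n\in\mathbb{N}^*}$ of real-valued maps on $\Omega$ with $Q_n$ measurable with respect to $\mathcal{F}_n$; by convention $Q_0=0$. Its defect is $\Psi_{n,m}(\omega)=Q_{n+m}(\omega)-Q_n(\omega)-Q_m(\theta_n\omega)$, $n,m\in\mathbb{N}$. $\chi_2(\mu;\mathcal{Q}):=\mathbb{E}^\mu[|Q_1|^2]$; finite second moment means $\chi_2(\mu;\mathcal{Q})<\infty$.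 Second-moment deviation inequality: $\tau_2(\mu;\mathcal{Q})<\infty$ is a constant with $\mathbb{E}^\mu[|\Psi_{n,m}|^2]\le\tau_2(\mu;\mathcal{Q})$ for all $n,m\in\mathbb{N}$. *)

(* Defs.v *)
From HB Require Import structures.
From mathcomp Require Import all_boot all_order all_algebra.
From mathcomp Require Import all_classical all_reals all_analysis.

Set Implicit Arguments.
Unset Strict Implicit.
Unset Printing Implicit Defensive.

Import Order.TTheory GRing.Theory Num.Theory.

Local Open Scope classical_set_scope.
Local Open Scope ring_scope.

(* Sequences are indexed from 1 on paper and from 0 here: entry k of
   w : nat -> G is w_{k+1}.  Hence X_n w = w n.-1, to be used for n >= 1 only
   (coordinate 0 coincides with coordinate 1). *)
Definition coordinate (G : Type) (n : nat) (w : nat -> G) : G := w n.-1.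

Definition coord_sets d (G : measurableType d) : set (set (nat -> G)) :=
  \bigcup_(n in [set n | (0 < n)%N])
    preimage_set_system setT (coordinate n) measurable.

Notation Omega G := (g_sigma_algebraType (@coord_sets _ G)).

(* The library has no infinite product measure.  By the pi-lambda theorem at
   most one probability on the product sigma-field satisfies the following, and
   one exists for every mu, with no topological assumption on G. *)
Definition is_product_measure d (G : measurableType d) (R : realType)
    (mu : probability G R) (P : probability (Omega G) R) : Prop :=
  forall (n : nat) (A : nat -> set G),
    (forall k, (1 <= k <= n)%N -> measurable (A k)) ->
    P [set w | forall k, (1 <= k <= n)%N -> A k (coordinate k w)] =
    (\prod_(1 <= k < n.+1) mu (A k))%E.

Definition filtration_sigma d (G : measurableType d) (n : nat) :
    set (set (Omega G)) :=
  g_sigma_preimage (fun i : 'I_n => coordinate i.+1).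

Definition shift (G : Type) (n : nat) (w : nat -> G) : nat -> G :=
  fun k => w (n + k)%N.

Definition defective_adapted_cocycle d (G : measurableType d) (R : realType)
    (Q : nat -> Omega G -> R) : Prop :=
  (forall w, Q 0%N w = 0) /\
  (forall n, (0 < n)%N ->
    forall B : set R, measurable B -> filtration_sigma n (Q n @^-1` B)).

Definition defect d (G : measurableType d) (R : realType)
    (Q : nat -> Omega G -> R) (n m : nat) (w : Omega G) : R :=
  Q (n + m)%N w - Q n w - Q m (shift n w).

Definition chi2 d (G : measurableType d) (R : realType)
    (P : probability (Omega G) R) (Q : nat -> Omega G -> R) : \bar R :=
  ('E_P[fun w => (`|Q 1%N w| ^+ 2)%R])%E.

Definition finite_second_moment d (G : measurableType d) (R : realType)
    (P : probability (Omega G) R) (Q : nat -> Omega G -> R) : Prop :=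
  (chi2 P Q < +oo)%E.

Definition second_moment_deviation d (G : measurableType d) (R : realType)
    (P : probability (Omega G) R) (Q : nat -> Omega G -> R) (tau2 : R) : Prop :=
  forall n m : nat, ('E_P[fun w => (`|defect Q n m w| ^+ 2)%R] <= tau2%:E)%E.

Definition Cplus d (G : measurableType d) (R : realType)
    (P : probability (Omega G) R) (Q : nat -> Omega G -> R) (tau2 : R) :
    \bar R :=
  (4%:E * chi2 P Q + 16%:E * tau2%:E)%E.

(* Main.v *)
(* Splitting a point of Omega into its first coordinate and the shifted point
   exhibits P as the image of mu \x P, hence shift-invariant.  By induction on
   the number of coordinates this gives the Efron-Stein inequality
     V(f) <= sum_(k < n) E (f - g_k)^2
   whenever f depends on the first n coordinates only and g_k does not depend on
   coordinate k.  For f = Q_n one takes (coordinates numbered from 0)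
     g_k = Q_k + Q_(n-k-1) o theta_(k+1),
   so that f - g_k = Psi_(k,n-k) + Psi_(1,n-k-1) o theta_k + Q_1 o theta_k has
   second moment at most 3 (2 tau2 + chi2) <= 4 chi2 + 16 tau2. *)
Require Import Defs.
From HB Require Import structures.
From mathcomp Require Import all_boot all_order all_algebra.
From mathcomp Require Import all_classical all_reals all_analysis.
From mathcomp Require Import measurable_realfun ring lra.

Set Implicit Arguments.
Unset Strict Implicit.
Unset Printing Implicit Defensive.

Import Order.TTheory GRing.Theory Num.Theory.
Local Open Scope classical_set_scope.
Local Open Scope ring_scope.

(** * Second moments and variances *)

Section square_integrable.
Context d (T : measurableType d) (R : realType) (P : probability T R).
Implicit Types f g h : T -> R.

Lemma Lfun2_sqr f : measurable_fun setT f ->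
  ('E_P[fun w => (f w ^+ 2)%R] < +oo)%E -> f \in Lfun P 2%:E.
Proof.
move=> mf; rewrite unlock => foo; rewrite inE; apply/andP; split.
  by rewrite inE.
rewrite inE/= /finite_norm unlock; apply: poweR_lty.
rewrite (_ : (fun _ => _) = fun w => ((f w ^+ 2)%R)%:E)//.
by apply/funext => w /=; rewrite powR_mulrn// real_normK// num_real.
Qed.

Lemma expectation_sqr_lty f : f \in Lfun P 2%:E ->
  ('E_P[fun w => (f w ^+ 2)%R] < +oo)%E.
Proof.
move=> /Lfun2_integrable_sqr/integrable_fin_num.
rewrite unlock => /(_ measurableT).
by rewrite fin_numElt => /andP[].
Qed.

Lemma expectation_sqrB_cst f c : f \in Lfun P 2%:E ->
  ('E_P[fun w => ((f w - c) ^+ 2)%R] =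
   'V_P[f] + ((fine 'E_P[f] - c) ^+ 2)%:E)%E.
Proof.
move=> f2; have c2 : cst c \in Lfun P 2%:E by exact: Lfun_cst.
have L1 h : h \in Lfun P 2%:E -> h \in Lfun P 1.
  by apply: Lfun_subset12; rewrite fin_num_measure.
have fc2 : (f \- cst c)%R \in Lfun P 2%:E by rewrite rpredB//= lee1n.
rewrite -(varianceB_cst_r c f2) varianceE//.
rewrite expectationB ?L1// expectation_cst.
have /fineK <- := expectation_fin_num (L1 _ f2).
by rewrite -EFinB -EFin_expe subeK.
Qed.

Lemma variance_le_sqrB_cst f c : f \in Lfun P 2%:E ->
  ('V_P[f] <= 'E_P[fun w => ((f w - c) ^+ 2)%R])%E.
Proof.
by move=> f2; rewrite expectation_sqrB_cst// leeDl// lee_fin sqr_ge0.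
Qed.

(** The squared mean of [f - h] is at most its second moment, since a variance is nonnegative. If
    the right side is finite then [h = f - (f - h)] is square integrable; otherwise there is nothing
    to show. *)
Lemma sqr_expectationB_le f h : f \in Lfun P 2%:E -> measurable_fun setT h ->
  (((fine 'E_P[f] - fine 'E_P[h]) ^+ 2)%:E <=
   'E_P[fun w => ((f w - h w) ^+ 2)%R])%E.
Proof.
move=> f2 mh; have [->|] := eqVneq 'E_P[fun w => ((f w - h w) ^+ 2)%R]%E +oo%E.
  by rewrite leey.
rewrite -ltey => fh; have mf : measurable_fun setT f.
  by have /sub_Lfun_mfun := f2; rewrite inE.
have fh2 : (f \- h)%R \in Lfun P 2%:E.
  by apply: Lfun2_sqr => //; exact: measurable_funB.
have h2 : h \in Lfun P 2%:E.
  rewrite (_ : h = f \- (f \- h))%R; last by apply/funext => w /=; rewrite subKr.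
  by rewrite rpredB//= lee1n.
have L1 g : g \in Lfun P 2%:E -> g \in Lfun P 1.
  by apply: Lfun_subset12; rewrite fin_num_measure.
have := expectation_sqrB_cst 0 fh2.
under [in X in X = _]eq_fun do rewrite subr0.
move=> ->; rewrite subr0 expectationB ?L1// fineB ?expectation_fin_num ?L1//.
by rewrite leeDr// variance_ge0.
Qed.

Lemma expectation_sqrD3_le f g h :
  measurable_fun setT f -> measurable_fun setT g -> measurable_fun setT h ->
  ('E_P[fun w => ((f w + g w + h w) ^+ 2)%R] <=
   3%:E * ('E_P[fun w => (f w ^+ 2)%R] + 'E_P[fun w => (g w ^+ 2)%R]
           + 'E_P[fun w => (h w ^+ 2)%R]))%E.
Proof.
move=> mf mg mh; rewrite unlock.
have ms (u : T -> R) : measurable_fun setT u ->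
    measurable_fun setT (fun w => ((u w ^+ 2)%R)%:E).
  by move=> mu; apply/measurable_EFinP; exact: measurable_funX.
have s0 (u : T -> R) (w : T) : setT w -> (0 <= ((u w ^+ 2)%R)%:E)%E.
  by move=> _; rewrite lee_fin sqr_ge0.
rewrite -ge0_integralD//; last 4 first.
- exact: s0.
- exact: ms.
- exact: s0.
- exact: ms.
rewrite -ge0_integralD//; last 4 first.
- by move=> w _; rewrite -EFinD lee_fin addr_ge0// sqr_ge0.
- by apply: emeasurable_funD; exact: ms.
- exact: s0.
- exact: ms.
rewrite -ge0_integralZl//; last 2 first.
- by do 2 (apply: emeasurable_funD; last exact: ms); exact: ms.
- by move=> w _; rewrite -!EFinD lee_fin !addr_ge0// sqr_ge0.
apply: ge0_le_integral => //.
- exact: (s0 (fun w => f w + g w + h w)).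
- apply: (ms (fun w => f w + g w + h w)).
  by do 2 (apply: measurable_funD => //).
- apply: measurable_funeM.
  by do 2 (apply: emeasurable_funD; last exact: ms); exact: ms.
- move=> w _; rewrite -!EFinD -EFinM lee_fin.
  (* For reals a, b, c, the difference 3(a^2 + b^2 + c^2) - (a + b + c)^2 is the sum of the squares
     of the pairwise differences. *)
  have := (sqr_ge0 (f w - g w), sqr_ge0 (g w - h w), sqr_ge0 (f w - h w)).
  by move=> [[]]; nra.
Qed.

End square_integrable.

(** * Prepending a coordinate and shifting, as measurable maps *)

Section cons_shift.
Context d (G : measurableType d).

Definition consw (p : G * Omega G) : Omega G :=
  fun k => if k is k'.+1 then p.2 k' else p.1.

Lemma measurable_eval i : measurable_fun setT (fun w : Omega G => w i).
Proof.
move=> _ A mA; apply: sub_sigma_algebra.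
by exists i.+1 => //; exists A.
Qed.

Lemma measurable_Omega d' (T : measurableType d') (f : T -> Omega G) :
  (forall i, measurable_fun setT (fun t => f t i)) -> measurable_fun setT f.
Proof.
move=> mf; apply: (@measurability _ _ T (Omega G) setT f (@coord_sets _ G)) => //.
move=> _ [_ [[|n] //= _ [A mA <-]] <-].
by rewrite setTI; exact: (mf n measurableT A mA).
Qed.

Lemma measurable_consw : measurable_fun setT consw.
Proof.
apply: measurable_Omega => -[|i] /=; first exact: measurable_fst.
exact: (measurableT_comp (measurable_eval i) measurable_snd).
Qed.

(* Typed on Omega, so that it is seen as a map of measurable spaces; the name
   shift of Defs is shadowed by the libraries. *)
Definition theta n : Omega G -> Omega G := @Defs.shift G n.

Lemma measurable_theta n : measurable_fun setT (theta n).
Proof. by apply: measurable_Omega => i; exact: measurable_eval. Qed.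

(** The single shift acts first, so that an induction on [n] can peel off the coordinate added by
    [consw]. *)
Lemma thetaS n (w : Omega G) : theta n.+1 w = theta n (theta 1 w).
Proof. by apply/funext => i; rewrite /theta /Defs.shift addnA add1n. Qed.

End cons_shift.

(** * Shift invariance and the Efron-Stein inequality *)

Section product_measure.
Context d (G : measurableType d) (R : realType).
Variables (mu : probability G R) (P : probability (Omega G) R).
Hypothesis hP : is_product_measure mu P.

Definition cylinder n (A : nat -> set G) : set (Omega G) :=
  [set w | forall k, (1 <= k <= n)%N -> A k (coordinate k w)].

Definition cylinders : set (set (Omega G)) :=
  [set C | exists n A, (forall k, measurable (A k)) /\ C = cylinder n A].

Lemma setI_closed_cylinders : setI_closed cylinders.
Proof.
move=> _ _ [n [A [mA ->]]] [m [B [mB ->]]].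
(* Each family is padded with [setT] beyond its own length. *)
exists (maxn n m), (fun k => (if (k <= n)%N then A k else setT) `&`
                             (if (k <= m)%N then B k else setT)); split.
  by move=> k; apply: measurableI; case: ifP.
apply/seteqP; split => w.
  move=> [Aw Bw] k /andP[k0 _]; split; case: ifP => // kn.
  - by apply: Aw; rewrite k0.
  - by apply: Bw; rewrite k0.
move=> ABw; split => k /andP[k0 kn].
- by move: (ABw k); rewrite k0 leq_max kn => /(_ isT)[].
- by move: (ABw k); rewrite k0 leq_max kn orbT => /(_ isT)[].
Qed.

Lemma cylinders_generate : @measurable _ (Omega G) = <<s cylinders>>.
Proof.
apply/seteqP; split.
  apply: sub_sigma_algebra2 => _ [[|n] //= _ [B mB <-]].
  exists n.+1, (fun k => if k == n.+1 then B else setT); split.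
    by move=> k; case: ifP.
  rewrite setTI; apply/seteqP; split => w /=.
    by move=> Bw k _; case: eqP => // ->.
  by move=> /(_ n.+1); rewrite eqxx ltnSn; exact.
apply: smallest_sub; first exact: sigma_algebra_measurable.
move=> _ [n [A [mA ->]]].
rewrite [cylinder n A](_ : _ =
    \bigcap_(k in [set k | (1 <= k <= n)%N]) ((fun w => w k.-1) @^-1` A k))//.
apply: bigcap_measurableType => k _.
rewrite -[X in measurable X]setTI.
exact: (measurable_eval k.-1 measurableT (mA k)).
Qed.

(** The preimage is the rectangle [A 1] times the cylinder of the shifted family, and the product
    formula splits off its first factor in the same way. *)
Lemma product_measure_cylinder n A : (forall k, measurable (A k)) ->
  (mu \x P)%E (@consw _ G @^-1` cylinder n A) = P (cylinder n A).
Proof.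
move=> mA; rewrite [RHS]hP//.
case: n => [|n].
  rewrite big_geq//.
  rewrite (_ : @consw _ G @^-1` cylinder 0 A = setT `*` setT).
    rewrite product_measure1E// -[RHS]mule1.
    by congr (_ * _)%E; exact: probability_setT.
  by apply/seteqP; split => // p _ k; case: k.
rewrite (_ : @consw _ G @^-1` _ = A 1%N `*` cylinder n (fun k => A k.+1)).
  rewrite product_measure1E//.
    rewrite big_ltn// big_add1; congr (_ * _)%E.
    exact: (hP (A := fun k => A k.+1)).
  have -> := cylinders_generate.
  by apply: sub_sigma_algebra; exists n, (fun k => A k.+1).
apply/seteqP; split => [[x w] /= Axw|[x w] /= [Ax Aw] [|[|k]]//].
  split; first exact: (Axw 1%N).
  by move=> [|k]// /andP[_ kn]; exact: (Axw k.+2).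
by move=> /andP[_ kn]; exact: (Aw k.+1).
Qed.

(** Finite measures that agree on a generating pi-system are equal; the cylinder of length 0 is the
    whole space and provides the exhausting sequence. *)
Lemma pushforward_consw (B : set (Omega G)) : measurable B ->
  P B = pushforward (mu \x P)%E (@consw _ G) B.
Proof.
move=> mB.
apply: (@measure_unique _ R (Omega G) cylinders (fun=> setT) cylinders_generate
  setI_closed_cylinders _ _ P (pushforward (mu \x P)%E (@consw _ G))) => //.
- by move=> _; exists 0%N, (fun=> setT); split => //; apply/seteqP; split.
- by rewrite bigcup_const//; exists 0%N.
- exact: measurable_consw.
- by move=> mc _ [n [A [mA ->]]]; exact: esym (product_measure_cylinder _ _).
- by move=> _; apply: le_lt_trans (ltry 1); exact: probability_le1.
Qed.

Lemma ge0_expectation_consw (F : Omega G -> R) :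
  measurable_fun setT F -> (forall w, 0 <= F w)%R ->
  ('E_P[F] = \int[mu]_x 'E_P[fun w => F (consw (x, w))])%E.
Proof.
move=> mF F0; rewrite unlock.
transitivity (\int[pushforward (mu \x P)%E (@consw _ G)]_w (F w)%:E)%E.
  apply: eq_measure_integral => [|mc A mA _]; first exact: measurable_consw.
  exact: pushforward_consw.
rewrite ge0_integral_pushforward//; last 3 first.
- exact: measurable_consw.
- exact/measurable_EFinP.
- by move=> w _; rewrite lee_fin.
rewrite fubini_tonelli1//= => [|p]; last by rewrite lee_fin.
apply/measurable_EFinP; apply: measurableT_comp => //; exact: measurable_consw.
Qed.

Lemma measurable_expectation_consw (F : Omega G -> R) :
  measurable_fun setT F -> (forall w, 0 <= F w)%R ->
  measurable_fun setT (fun x => 'E_P[fun w => F (consw (x, w))])%E.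
Proof.
move=> mF F0; rewrite unlock.
apply: (measurable_fun_fubini_tonelli_F (fun p => (F (consw p))%:E)) => //=.
  apply/measurable_EFinP; apply: measurableT_comp => //; exact: measurable_consw.
by move=> p; rewrite lee_fin.
Qed.

Lemma ge0_expectation_theta n (F : Omega G -> R) :
  measurable_fun setT F -> (forall w, 0 <= F w)%R ->
  ('E_P[F \o theta n] = 'E_P[F])%E.
Proof.
elim: n F => [//|n ih] F mF F0.
rewrite (_ : F \o _ = (F \o theta n) \o theta 1); last first.
  by apply/funext => w /=; rewrite thetaS.
have mFn : measurable_fun setT (F \o theta n).
  exact: measurableT_comp mF (measurable_theta n).
rewrite -[RHS]ih// ge0_expectation_consw; last 2 first.
- exact: measurableT_comp mFn (measurable_theta 1).
- by move=> w; exact: F0.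
(* By computation [theta 1 (consw (x, w))] is [w], so the inner expectation does not depend on
   [x]. *)
rewrite [LHS](_ : _ = \int[mu]_x cst ('E_P[F \o theta n]) x)%E.
  by rewrite integral_cst// -[RHS]mule1; congr (_ * _)%E; exact: probability_setT.
by apply: eq_integral.
Qed.

Lemma measurable_section (f : Omega G -> R) x : measurable_fun setT f ->
  measurable_fun setT (fun w => f (consw (x, w))).
Proof.
move=> mf; apply: measurableT_comp => //; apply: measurableT_comp => //.
exact: measurable_consw.
Qed.

(** By Tonelli the second moments of the sections integrate to that of [f], so almost all of them
    are finite. *)
Lemma ae_section_Lfun2 (f : Omega G -> R) : f \in Lfun P 2%:E ->
  {ae mu, forall x, (fun w => f (consw (x, w))) \in Lfun P 2%:E}.
Proof.
move=> f2; have mf : measurable_fun setT f.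
  by have /sub_Lfun_mfun := f2; rewrite inE.
have mf2 : measurable_fun setT (fun w => f w ^+ 2)%R by exact: measurable_funX.
have f20 w : (0 <= f w ^+ 2)%R by exact: sqr_ge0.
have /integrable_ae : mu.-integrable setT
    (fun x => 'E_P[fun w => (f (consw (x, w)) ^+ 2)%R]%E).
  apply/integrableP; split; first exact: measurable_expectation_consw mf2 f20.
  under eq_integral do rewrite gee0_abs ?expectation_ge0//.
  rewrite -(ge0_expectation_consw mf2 f20); exact: expectation_sqr_lty.
move=> /(_ measurableT); apply: filterS => x /(_ Logic.I) fx.
by apply: Lfun2_sqr; [exact: measurable_section|rewrite ltey_eq fx].
Qed.

(** Fixing the first coordinate leaves functions of one coordinate fewer, to which the induction
    hypothesis applies with [g k.+1] in place of [g k]. The term of [g 0] pays for the dependence of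
    the section's mean on the fixed coordinate. *)
Lemma Efron_Stein n (f : Omega G -> R) (g : nat -> Omega G -> R) :
  f \in Lfun P 2%:E -> (forall k, measurable_fun setT (g k)) ->
  (forall w w', (forall i, (i < n)%N -> w i = w' i) -> f w = f w') ->
  (forall k w w', (k < n)%N -> (forall i, i != k -> w i = w' i) ->
    g k w = g k w') ->
  ('V_P[f] <= \sum_(k < n) 'E_P[fun w => ((f w - g k w) ^+ 2)%R])%E.
Proof.
elim: n f g => [|n ih] f g f2 mg fn gk.
  rewrite big_ord0 (_ : f = cst (f (point : Omega G))) ?variance_cst//.
  by apply/funext => w; exact: fn.
have mf : measurable_fun setT f.
  by have /sub_Lfun_mfun := f2; rewrite inE.
pose x0 : G := point.
pose c := fine 'E_P[fun w => g 0%N (consw (x0, w))]%E.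
have mfc : measurable_fun setT (fun w => (f w - c) ^+ 2)%R.
  by apply: measurable_funX; exact: measurable_funB.
have mfg k : measurable_fun setT (fun w => (f w - g k w) ^+ 2)%R.
  by apply: measurable_funX; exact: measurable_funB.
have sq0 (u : Omega G -> R) w : (0 <= u w ^+ 2)%R by exact: sqr_ge0.
(* The constant is chosen as the mean of the sections of g 0, which do not depend
   on the first coordinate x: then, sectionwise,
   E_x (f - c)^2 = V_x f + (E_x f - E_x (g 0))^2, so no measurability of the
   conditional mean E_x f is needed. *)
apply: (le_trans (variance_le_sqrB_cst c f2)).
rewrite (ge0_expectation_consw mfc (sq0 _)).
pose F k x := 'E_P[fun w => ((f (consw (x, w)) - g k (consw (x, w))) ^+ 2)%R]%E.
have mF k : measurable_fun setT (F k).
  exact: measurable_expectation_consw (mfg k) (sq0 _).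
have F0 k x : (0 <= F k x)%E by apply: expectation_ge0 => w; exact: sqr_ge0.
rewrite (eq_bigr (fun k : 'I_n.+1 => \int[mu]_x F k x)%E) => [|k _]; last first.
  exact: ge0_expectation_consw (mfg k) (sq0 _).
rewrite -(@ge0_integral_sum _ _ _ mu setT measurableT _
  (fun (k : 'I_n.+1) x => F k x))//.
(* The integrands are compared almost everywhere only, where the section of [f] is square
   integrable. *)
apply: ae_ge0_le_integral => //.
- by move=> x _; apply: expectation_ge0 => w; exact: sqr_ge0.
- exact: measurable_expectation_consw mfc (sq0 _).
- by move=> x _; exact: sume_ge0.
- by apply: emeasurable_sum.
apply: filterS (ae_section_Lfun2 f2) => x fx2 _.
have mgx k := measurable_section x (mg k).
(* The term k = 0 bounds the squared bias of the section; the others bound its variance, by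
   induction. *)
rewrite expectation_sqrB_cst// big_ord_recl addeC; apply: leeD.
  rewrite /c (_ : (fun w => g 0%N (consw (x0, w))) = fun w => g 0%N (consw (x, w))).
    exact: sqr_expectationB_le.
  by apply/funext => w; apply: gk => // -[].
apply: (ih (fun w => f (consw (x, w))) (fun k w => g k.+1 (consw (x, w)))) => //.
  by move=> w w' ww'; apply: fn => -[|i]//=; exact: ww'.
move=> k w w' kn ww'; apply: gk => // -[|i]//= ik; exact: ww'.
Qed.
End product_measure.

(** * Adapted functions depend on finitely many coordinates *)

Section adapted.
Context d (G : measurableType d) (R : realType).
Variable Q : nat -> Omega G -> R.
Hypothesis hQ : defective_adapted_cocycle Q.

Lemma filtration_sub n : filtration_sigma n `<=` @measurable _ (Omega G).
Proof.
apply: sub_sigma_algebra2.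
apply: (big_ind (fun S => S `<=` @coord_sets _ G)).
- exact: sub0set.
- by move=> S T SG TG; rewrite subUset.
- by move=> i _ B iB; exists i.+1.
Qed.

(** The sets containing both points or neither form a sigma-field, and it contains the generators of
    [filtration_sigma n]. *)
Lemma filtration_saturated n (B : set (Omega G)) (w w' : Omega G) :
  filtration_sigma n B -> (forall i, (i < n)%N -> w i = w' i) -> B w <-> B w'.
Proof.
move=> + ww'; pose S := [set B : set (Omega G) | B w <-> B w'].
suff: @filtration_sigma _ G n `<=` S by exact.
apply: smallest_sub.
  split => [//|A SA|A SA]; rewrite /S/=.
    by split => -[_ nA]; split => // /SA.
  by split => -[k _ /SA Ak]; exists k.
apply: (big_ind (fun C => C `<=` S)).
- exact: sub0set.
- by move=> C D CS DS; rewrite subUset.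
- move=> i _ _ [A mA <-]; rewrite setTI /S /= /preimage /coordinate/=.
  by rewrite ww'.
Qed.

Lemma measurable_cocycle n : measurable_fun setT (Q n).
Proof.
have [Q0 Qn] := hQ; case: n => [|n].
  by rewrite (_ : Q 0%N = cst 0)//; apply/funext.
by move=> _ B mB; rewrite setTI; apply: (@filtration_sub n.+1); exact: Qn.
Qed.

(** The fibre of [Q n] through [w'] is the preimage of a measurable singleton, so it cannot separate
    [w] from [w']. *)
Lemma cocycle_local n (w w' : Omega G) :
  (forall i, (i < n)%N -> w i = w' i) -> Q n w = Q n w'.
Proof.
have [Q0 Qn] := hQ; case: n => [|n] ww'; first by rewrite !Q0.
have QB := Qn n.+1 isT _ (measurable_set1 (Q n.+1 w')).
by apply/(filtration_saturated QB ww').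
Qed.

Lemma measurable_defect n m : measurable_fun setT (defect Q n m).
Proof.
apply: measurable_funB; last first.
  exact: measurableT_comp (measurable_cocycle m) (@measurable_theta _ G n).
by apply: measurable_funB; exact: measurable_cocycle.
Qed.

End adapted.

Theorem theorem4p4 (d : measure_display) (G : measurableType d) (R : realType)
    (mu : probability G R) (P : probability (Omega G) R)
    (hP : is_product_measure mu P)
    (Q : nat -> Omega G -> R) (hQ : defective_adapted_cocycle Q)
    (hchi : finite_second_moment P Q)
    (tau2 : R) (htau : second_moment_deviation P Q tau2)
    (n : nat) (hn : (1 <= n)%N) :
  ('V_P[Q n] <= Cplus P Q tau2 * n%:R%:E)%E.
Proof.
have mQ := measurable_cocycle hQ; have mPsi := measurable_defect hQ.
have [Q0 _] := hQ.
have sqE (f : Omega G -> R) : (fun w => `|f w| ^+ 2) = (fun w => f w ^+ 2).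
  by apply/funext => w; rewrite real_normK// num_real.
have tau_le i j : ('E_P[fun w => (defect Q i j w ^+ 2)%R] <= tau2%:E)%E.
  by rewrite -sqE.
have tau_ge0 : (0 <= tau2%:E)%E.
  by apply: le_trans (tau_le 0%N 0%N); apply: expectation_ge0 => w; exact: sqr_ge0.
have chiE : chi2 P Q = 'E_P[fun w => (Q 1%N w ^+ 2)%R]%E.
  by rewrite /chi2 sqE.
have chi_ge0 : (0 <= chi2 P Q)%E.
  by rewrite chiE; apply: expectation_ge0 => w; exact: sqr_ge0.
have mtheta k (f : Omega G -> R) : measurable_fun setT f ->
    measurable_fun setT (f \o theta k).
  by move=> mf; exact: measurableT_comp mf (measurable_theta k).
have invariant k (f : Omega G -> R) : measurable_fun setT f ->
    ('E_P[fun w => (f (theta k w) ^+ 2)%R] = 'E_P[fun w => (f w ^+ 2)%R])%E.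
  move=> mf; apply: (ge0_expectation_theta hP k (F := fun w => f w ^+ 2)).
    exact: measurable_funX.
  by move=> w; exact: sqr_ge0.
(* Induction through Q_(k+1) = Psi_(k,1) + Q_k + Q_1 o theta_k, with shift invariance for the last
   term. *)
have Q2 k : Q k \in Lfun P 2%:E.
  apply: Lfun2_sqr => //; elim: k => [|k ih].
    rewrite (_ : (fun _ => _) = cst 0) ?expectation_cst ?ltry//.
    by apply/funext => w; rewrite Q0 expr0n.
  rewrite (_ : (fun _ => _) =
      fun w => (defect Q k 1 w + Q k w + (Q 1%N \o theta k) w) ^+ 2).
    apply: le_lt_trans; first by apply: expectation_sqrD3_le => //; exact: mtheta.
    rewrite invariant// -chiE lte_mul_pinfty// !lte_add_pinfty//.
    exact: le_lt_trans (tau_le _ _) (ltry _).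
  by apply/funext => w; rewrite /defect addn1 /theta/=; congr (_ ^+ 2); ring.
(* The first term reads the coordinates before k, the second those after k. The truncated
   subtraction is exact for k < n, the only range that enters the sum. *)
pose g k w := Q k w + Q (n - k.+1)%N (theta k.+1 w).
have mg k : measurable_fun setT (g k).
  by apply: measurable_funD => //; exact: mtheta.
have := Efron_Stein hP (Q2 n) mg (cocycle_local hQ (n := n)).
have gk k w w' : (k < n)%N -> (forall i, i != k -> w i = w' i) -> g k w = g k w'.
  move=> kn ww'; congr (_ + _); apply: cocycle_local => // i ik.
    by apply: ww'; rewrite ltn_eqF.
  by apply: ww'; rewrite gtn_eqF// ltnS leq_addr.
move=> /(_ gk) /le_trans; apply.
have incr k : (k < n)%N -> ('E_P[fun w => ((Q n w - g k w) ^+ 2)%R] <=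
    Cplus P Q tau2)%E.
  move=> kn.
  (* Q_(n-k) o theta_k cancels between the two defects, and Q_1 o theta_k between the second defect
     and the last term. *)
  rewrite (_ : (fun _ => _) = fun w => (defect Q k (n - k) w +
      (defect Q 1 (n - k.+1) \o theta k) w + (Q 1%N \o theta k) w) ^+ 2).
    apply: le_trans.
      by apply: expectation_sqrD3_le => //; exact: mtheta.
    rewrite !invariant// -chiE.
    apply: (@le_trans _ _ (3%:E * (tau2%:E + tau2%:E + chi2 P Q))%E).
      by rewrite lee_pmul2l//; do !apply: leeD.
    rewrite /Cplus.
    (* The finite second moment moves the inequality to the reals, where 6 tau2 + 3 chi2 <= 16 tau2
       + 4 chi2 is linear arithmetic. *)
    have /fineK <- : chi2 P Q \is a fin_num by rewrite ge0_fin_numE.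
    rewrite -!EFinD -!EFinM lee_fin.
    have : 0 <= fine (chi2 P Q) by exact: fine_ge0.
    by move: tau_ge0; rewrite lee_fin; lra.
  apply/funext => w; rewrite /defect /g /theta/= subnKC ?(ltnW kn)//.
  rewrite add1n -subSn// subSS.
  have -> : Defs.shift 1 (Defs.shift k w) = Defs.shift k.+1 w.
    by apply/funext => i; rewrite /Defs.shift addnA addn1.
  by congr (_ ^+ 2); ring.
apply: le_trans; first by apply: lee_sum => k _; exact: incr.
by rewrite sumr_const card_ord muleC mule_natl.
Qed.
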